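(* Let $(X,\cdot_X,\mathbb{C}_X)$ and $(Y,\cdot_Y,\mathbb{C}_Y)$ be $\top$-convergence groups, let $C(X,Y)$ be the set of continuous maps $(X,\mathbb{C}_X)\to(Y,\mathbb{C}_Y)$ with the pointwise operation $(f\cdot g)(x)=f(x)\cdot_Y g(x)$, and let $(C(X,Y),\mathbb{C})$ be the power object of $(X,\mathbb{C}_X)$ and $(Y,\mathbb{C}_Y)$ in the category of $\top$-convergence spaces. Then the triple $(C(X,Y),\cdot,\mathbb{C})$ is a $\top$-convergence group.
   Context: Throughout, $L=(L,\ast)$ is a complete residuated lattice: $(L,\le)$ is a complete lattice with top $\top$ and bottom $\bot$, and $\ast$ is a commutative associative binary operation on $L$ with $a\ast\bigvee_{j}b_j=\bigvee_j(a\ast b_j)$ and $a\ast\top=a$. Moreover, it is assumed that $L$ satisfies the law (CD): $a\wedge\bigvee_{j\in J}b_j=\bigvee_{j\in J}(a\wedge b_j)$ for all $a\in L$ and all families $\{b_j\}_{j\in J}$ in $L$. Put $a\to b=\bigvee\{c\in L: a\ast c\le b\}$. $L^X$ is the set of all maps $X\to L$, with pointwise order and operations. For $\lambda,\mu\in L^X$, $S_X(\lambda,\mu)=\bigwedge_{x\in X}(\lambda(x)\to\mu(x))$. A $\top$-filter on $X$ is a nonempty $\mathbb{F}\subseteq L^X$ such that: $\bigvee_{x\in X}\lambda(x)=\top$ for all $\lambda\in\mathbb{F}$; $\lambda\wedge\mu\in\mathbb{F}$ for all $\lambda,\mu\in\mathbb{F}$; and for $\lambda\in L^X$, $\bigvee_{\mu\in\mathbb{F}}S_X(\mu,\lambda)=\top$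 implies $\lambda\in\mathbb{F}$. $\mathbb{F}_L^\top(X)$ is the set of $\top$-filters on $X$. A $\top$-filter base on $X$ is a nonempty $\mathbb{B}\subseteq L^X$ such that $\bigvee_{x}\lambda(x)=\top$ for all $\lambda\in\mathbb{B}$ and $\bigvee_{\nu\in\mathbb{B}}S_X(\nu,\lambda\wedge\mu)=\top$ for all $\lambda,\mu\in\mathbb{B}$; it generates the $\top$-filter $\{\lambda\in L^X:\bigvee_{\mu\in\mathbb{B}}S_X(\mu,\lambda)=\top\}$. For $x\in X$, $[x]_\top=\{\mu\in L^X:\mu(x)=\top\}$ (a $\top$-filter). For a map $f:X\to Y$ and $\mathbb{F}\in\mathbb{F}_L^\top(X)$, $f^\Rightarrow(\mathbb{F})=\{\mu\in L^Y:\mu\circ f\in\mathbb{F}\}\in\mathbb{F}_L^\top(Y)$. For $\mathbb{F}_i\in\mathbb{F}_L^\top(X_i)$ $(i=1,2)$, $\mathbb{F}_1\times\mathbb{F}_2$ is the $\top$-filter on $X_1\times X_2$ generated by the $\top$-filter base $\{\lambda_1\times\lambda_2:\lambda_i\in\mathbb{F}_i\}$, where $(\lambda_1\times\lambda_2)(x_1,x_2)=\lambda_1(x_1)\wedge\lambda_2(x_2)$. A $\top$-convergence space is a pair $(X,\mathbb{C})$ with $\mathbb{C}:\mathbb{F}_L^\top(X)\to 2^X$, writing $\mathbb{F}\stackrel{\mathbb{C}}{\dashrightarrow}x$ for $x\in\mathbb{C}(\mathbb{F})$, such that (TC1) $[x]_\top\stackrel{\mathbb{C}}{\dashrightarrow}x$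 for all $x\in X$; (TC2) $\mathbb{F}\subseteq\mathbb{G}$ and $\mathbb{F}\stackrel{\mathbb{C}}{\dashrightarrow}x$ imply $\mathbb{G}\stackrel{\mathbb{C}}{\dashrightarrow}x$. A map $f:(X,\mathbb{C}_X)\to(Y,\mathbb{C}_Y)$ is continuous if $\mathbb{F}\stackrel{\mathbb{C}_X}{\dashrightarrow}x$ implies $f^\Rightarrow(\mathbb{F})\stackrel{\mathbb{C}_Y}{\dashrightarrow}f(x)$. The product structure $\mathbb{C}\times\mathbb{C}$ on $X\times X$ is given by $\mathbb{F}\stackrel{\mathbb{C}\times\mathbb{C}}{\dashrightarrow}(x_1,x_2)$ iff $p_i^\Rightarrow(\mathbb{F})\stackrel{\mathbb{C}}{\dashrightarrow}x_i$ for $i=1,2$, where $p_1,p_2$ are the projections. For a group $(X,\cdot)$ and a $\top$-convergence space $(X,\mathbb{C})$, the triple $(X,\cdot,\mathbb{C})$ is a $\top$-convergence group if $m:(X\times X,\mathbb{C}\times\mathbb{C})\to(X,\mathbb{C})$, $(x,y)\mapsto xy$, and $r:(X,\mathbb{C})\to(X,\mathbb{C})$, $x\mapsto x^{-1}$, are continuous. Power object: for $\top$-convergence spaces $(X,\mathbb{C}_X),(Y,\mathbb{C}_Y)$, let $C(X,Y)$ be the set of continuous maps from $(X,\mathbb{C}_X)$ to $(Y,\mathbb{C}_Y)$ and $ev:C(X,Y)\times X\to Y$, $ev(f,x)=f(x)$. The $\top$-convergence structure $\mathbb{C}$ on $C(X,Y)$ is defined, for $\mathbb{F}\in\mathbb{F}_L^\top(C(X,Y))$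 and $f\in C(X,Y)$, by: $\mathbb{F}\stackrel{\mathbb{C}}{\dashrightarrow}f$ iff for all $x\in X$ and all $\mathbb{G}\in\mathbb{F}_L^\top(X)$, $\mathbb{G}\stackrel{\mathbb{C}_X}{\dashrightarrow}x$ implies $ev^\Rightarrow(\mathbb{F}\times\mathbb{G})\stackrel{\mathbb{C}_Y}{\dashrightarrow}f(x)$. The pair $(C(X,Y),\mathbb{C})$ is called the power object in the category of $\top$-convergence spaces. *)

(* Defs.v *)
From HB Require Import structures.
From mathcomp Require Import all_boot all_order.
From mathcomp Require Import boolp classical_sets.

Set Implicit Arguments.
Unset Strict Implicit.
Unset Printing Implicit Defensive.

Import Order.TTheory.
Local Open Scope classical_set_scope.
Local Open Scope order_scope.

HB.mixin Record TBLattice_isComplete d L of Order.TBLattice d L := {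
  bigjoin : set L -> L;
  bigjoin_supremum : forall A : set L, supremums A (bigjoin A)
}.

#[short(type="completeLatticeType")]
HB.structure Definition CompleteLattice d :=
  {L of TBLattice_isComplete d L & Order.TBLattice d L}.

(* [resmul_bigjoin] includes [resmul a \bot = \bot], as the join of the empty
   set.  Families of elements of L are represented by their ranges. *)
HB.mixin Record CompleteLattice_isResiduated d L of CompleteLattice d L := {
  resmul : L -> L -> L;
  resmulC : commutative resmul;
  resmulA : associative resmul;
  resmul_top : forall a : L, resmul a \top = a;
  resmul_bigjoin : forall (a : L) (B : set L),
    resmul a (bigjoin B) = bigjoin [set resmul a b | b in B]
}.

#[short(type="residuatedLatticeType")]
HB.structure Definition ResiduatedLattice d :=
  {L of CompleteLattice_isResiduated d L & CompleteLattice d L}.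

HB.mixin Record ResiduatedLattice_isCD d L of ResiduatedLattice d L := {
  meet_bigjoin : forall (a : L) (B : set L),
    Order.meet a (bigjoin B) = bigjoin [set Order.meet a b | b in B]
}.

#[short(type="cdResiduatedLatticeType")]
HB.structure Definition CDResiduatedLattice d :=
  {L of ResiduatedLattice_isCD d L & ResiduatedLattice d L}.

Definition bigmeet d (L : completeLatticeType d) (A : set L) : L :=
  bigjoin (lbound A).

Definition resid d (L : residuatedLatticeType d) (a b : L) : L :=
  bigjoin [set c : L | resmul a c <= b].

Definition fmeet d (L : completeLatticeType d) X (f g : X -> L) : X -> L :=
  fun x => Order.meet (f x) (g x).

Definition subhood d (L : residuatedLatticeType d) X (f g : X -> L) : L :=
  bigmeet (range (fun x => resid (f x) (g x))).

Record is_top_filter d (L : residuatedLatticeType d) X (F : set (X -> L)) :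
    Prop := IsTopFilter {
  top_filter_nonempty : F !=set0;
  top_filter_join : forall f, F f -> bigjoin (range f) = \top;
  top_filter_meet : forall f g, F f -> F g -> F (fmeet f g);
  top_filter_sat : forall g,
    bigjoin [set subhood f g | f in F] = \top -> F g
}.

Record is_top_filter_base d (L : residuatedLatticeType d) X
    (B : set (X -> L)) : Prop := IsTopFilterBase {
  top_base_nonempty : B !=set0;
  top_base_join : forall f, B f -> bigjoin (range f) = \top;
  top_base_meet : forall f g, B f -> B g ->
    bigjoin [set subhood h (fmeet f g) | h in B] = \top
}.

Record top_filter d (L : residuatedLatticeType d) (X : Type) := TopFilter {
  top_filter_set :> set (X -> L);
  top_filterP : is_top_filter top_filter_set
}.

Section CompleteLatticeTheory.
Context d (L : completeLatticeType d).
Implicit Types (a b : L) (A : set L).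

Lemma le_bigjoin A a : A a -> a <= bigjoin A.
Proof. by have [ubA _] := bigjoin_supremum A; apply: ubA. Qed.

Lemma bigjoin_le A a : (forall b, A b -> b <= a) -> bigjoin A <= a.
Proof. by have [_ lbA] := bigjoin_supremum A; move=> h; apply: lbA. Qed.

Lemma bigmeet_le A a : A a -> bigmeet A <= a.
Proof. by move=> Aa; apply: bigjoin_le => b; apply. Qed.

Lemma le_bigmeet A a : (forall b, A b -> a <= b) -> a <= bigmeet A.
Proof. by move=> h; apply: le_bigjoin. Qed.

Lemma bigjoin_top A : (exists2 a, A a & \top <= a) -> bigjoin A = \top.
Proof.
by move=> [a Aa a1]; apply/le_anti; rewrite lex1 (le_trans a1)// le_bigjoin.
Qed.

End CompleteLatticeTheory.

Section ResiduatedTheory.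
Context d (L : residuatedLatticeType d).
Implicit Types a b c : L.

Lemma resmul_le2l a b c : b <= c -> resmul a b <= resmul a c.
Proof.
move=> bc.
have -> : c = bigjoin [set b; c].
  apply/le_anti; rewrite le_bigjoin/=; last by right.
  by apply: bigjoin_le => x [->//|->].
by rewrite resmul_bigjoin; apply: le_bigjoin; exists b => //; left.
Qed.

Lemma resmul_le2 a b c e : a <= b -> c <= e -> resmul a c <= resmul b e.
Proof.
move=> ab ce; apply: (le_trans (resmul_le2l a ce)).
by rewrite (resmulC a) (resmulC b) resmul_le2l.
Qed.

Lemma resmul_lel a b : resmul a b <= a.
Proof. by rewrite -[leRHS]resmul_top resmul_le2l ?lex1. Qed.

Lemma resmul_ler a b : resmul a b <= b.
Proof. by rewrite resmulC resmul_lel. Qed.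

Lemma residP a b c : (c <= resid a b) = (resmul a c <= b).
Proof.
apply/idP/idP => [h|h]; last exact: le_bigjoin.
apply: (le_trans (resmul_le2l a h)).
by rewrite resmul_bigjoin; apply: bigjoin_le => _ [e /= he <-].
Qed.

Lemma subhoodP X (f g : X -> L) c :
  c <= subhood f g <-> (forall x, resmul (f x) c <= g x).
Proof.
split=> [h x|h].
  by rewrite -residP; apply: (le_trans h); apply: bigmeet_le; exists x.
by apply: le_bigmeet => _ [x _ <-]; rewrite residP.
Qed.

Lemma subhood_refl_le X (f g : X -> L) :
  (forall x, f x <= g x) -> \top <= subhood f g.
Proof. by move=> h; apply/subhoodP => x; rewrite resmul_top. Qed.

Lemma subhood_trans X (f g h : X -> L) :
  resmul (subhood f g) (subhood g h) <= subhood f h.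
Proof.
apply/subhoodP => x; rewrite resmulA.
have /subhoodP/(_ x) fg := lexx (subhood f g).
have /subhoodP/(_ x) gh := lexx (subhood g h).
by apply: le_trans gh; apply: resmul_le2.
Qed.

Lemma subhood_meet X (f g f' g' : X -> L) :
  resmul (subhood f f') (subhood g g') <=
  subhood (fmeet f g) (fmeet f' g').
Proof.
apply/subhoodP => x; rewrite lexI; apply/andP; split.
  have /subhoodP/(_ x) h := lexx (subhood f f').
  by apply: le_trans h; apply: resmul_le2; rewrite ?leIl ?resmul_lel.
have /subhoodP/(_ x) h := lexx (subhood g g').
by apply: le_trans h; apply: resmul_le2; rewrite ?leIr ?resmul_ler.
Qed.

Lemma resmul_top_le (A B : set L) c :
  bigjoin A = \top -> bigjoin B = \top ->
  (forall a b, A a -> B b -> resmul a b <= c) -> \top <= c.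
Proof.
move=> A1 B1 h; rewrite -[leLHS]resmul_top -{2}A1 resmul_bigjoin.
apply: bigjoin_le => _ [a Aa <-].
rewrite resmulC -B1 resmul_bigjoin; apply: bigjoin_le => _ [b Bb <-].
exact: h.
Qed.

Lemma subhood_join X (F : set (X -> L)) g :
  (forall f, F f -> bigjoin (range f) = \top) ->
  bigjoin [set subhood f g | f in F] = \top -> bigjoin (range g) = \top.
Proof.
move=> F1 Fg; apply/le_anti; rewrite lex1/= -Fg.
apply: bigjoin_le => _ [f Ff <-].
rewrite -[leLHS]resmul_top -(F1 _ Ff) resmul_bigjoin.
apply: bigjoin_le => _ [_ [x _ <-] <-]; rewrite resmulC.
have /subhoodP/(_ x) h := lexx (subhood f g).
by apply: (le_trans h); apply: le_bigjoin; exists x.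
Qed.

Lemma is_top_filter_generated X (B : set (X -> L)) :
  is_top_filter_base B ->
  is_top_filter [set g | bigjoin [set subhood f g | f in B] = \top].
Proof.
move=> bB; split=> /=.
- have [f Bf] := top_base_nonempty bB; exists f => /=.
  by apply: bigjoin_top; exists (subhood f f); [exists f|exact: subhood_refl_le].
- by move=> g; apply: subhood_join; exact: top_base_join.
- move=> f g Bf Bg; apply/le_anti; rewrite lex1/=.
  apply: (resmul_top_le Bf Bg) => _ _ [f' Bf' <-] [g' Bg' <-].
  rewrite -[leLHS]resmul_top -(top_base_meet bB Bf' Bg') resmul_bigjoin.
  apply: bigjoin_le => _ [_ [h Bh <-] <-]; rewrite resmulC.
  apply: le_trans (le_bigjoin _); last by exists h.
  apply: le_trans (subhood_trans _ _ _); apply: resmul_le2l.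
  exact: subhood_meet.
- move=> g Bg; apply/le_anti; rewrite lex1/= -Bg.
  apply: bigjoin_le => _ [f Bf <-].
  rewrite -[leLHS]resmul_top -Bf resmul_bigjoin.
  apply: bigjoin_le => _ [_ [h Bh <-] <-]; rewrite resmulC.
  apply: le_trans (le_bigjoin _); last by exists h.
  exact: subhood_trans.
Qed.

Definition generated_top_filter X (B : set (X -> L))
    (bB : is_top_filter_base B) : top_filter L X :=
  TopFilter (is_top_filter_generated bB).

Lemma is_top_filter_point X (x : X) :
  is_top_filter [set f : X -> L | f x = \top].
Proof.
split=> /=.
- by exists (fun=> \top).
- by move=> f fx; apply: bigjoin_top; exists (f x); [exists x|rewrite fx].
- by move=> f g; rewrite /fmeet => -> ->; rewrite meetxx.
- move=> g h; apply/le_anti; rewrite lex1/= -h.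
  apply: bigjoin_le => _ [f /= fx <-].
  by have /subhoodP/(_ x) := lexx (subhood f g); rewrite fx resmulC resmul_top.
Qed.

Definition top_filter_point X (x : X) : top_filter L X :=
  TopFilter (is_top_filter_point x).

Lemma is_top_filter_image X Y (f : X -> Y) (F : top_filter L X) :
  is_top_filter [set g : Y -> L | top_filter_set F (g \o f)].
Proof.
have fF := top_filterP F; split=> /=.
- exists (fun=> \top) => /=; apply: (top_filter_sat fF).
  have [h Fh] := top_filter_nonempty fF.
  apply: bigjoin_top; exists (subhood h (fun=> \top)); first by exists h.
  by apply: subhood_refl_le => x; rewrite lex1.
- move=> g /(top_filter_join fF) g1; apply/le_anti; rewrite lex1/= -g1.
  by apply: bigjoin_le => _ [x _ <-]; apply: le_bigjoin; exists (f x).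
- by move=> g h Fg Fh; exact: (top_filter_meet fF Fg Fh).
- move=> g g1; apply: (top_filter_sat fF).
  apply/le_anti; rewrite lex1/= -g1; apply: bigjoin_le => _ [h Fh <-].
  apply: le_trans (le_bigjoin _); last by exists (h \o f).
  by apply/subhoodP => x /=; move: (f x); apply/subhoodP.
Qed.

Definition top_filter_image X Y (f : X -> Y) (F : top_filter L X) :
    top_filter L Y :=
  TopFilter (is_top_filter_image f F).

End ResiduatedTheory.

Section Product.
Context d (L : cdResiduatedLatticeType d).

Definition fprod_meet X1 X2 (f1 : X1 -> L) (f2 : X2 -> L) : X1 * X2 -> L :=
  fun p => Order.meet (f1 p.1) (f2 p.2).

Definition top_filter_prod_base X1 X2
    (F1 : top_filter L X1) (F2 : top_filter L X2) : set (X1 * X2 -> L) :=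
  [set f | exists f1 f2, [/\ top_filter_set F1 f1, top_filter_set F2 f2 & f = fprod_meet f1 f2]].

Lemma is_top_filter_base_prod X1 X2
    (F1 : top_filter L X1) (F2 : top_filter L X2) :
  is_top_filter_base (top_filter_prod_base F1 F2).
Proof.
have [fF1 fF2] := (top_filterP F1, top_filterP F2); split.
- have [f1 Ff1] := top_filter_nonempty fF1.
  have [f2 Ff2] := top_filter_nonempty fF2.
  by exists (fprod_meet f1 f2), f1, f2.
- move=> _ [f1 [f2 [Ff1 Ff2 ->]]]; apply/le_anti; rewrite lex1/=.
  rewrite -(top_filter_join fF1 Ff1); apply: bigjoin_le => _ [x1 _ <-].
  rewrite -[leLHS]meetx1 -(top_filter_join fF2 Ff2) meet_bigjoin.
  apply: bigjoin_le => _ [_ [x2 _ <-] <-].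
  by apply: le_bigjoin; exists (x1, x2).
- move=> _ _ [f1 [f2 [Ff1 Ff2 ->]]] [g1 [g2 [Fg1 Fg2 ->]]].
  apply: bigjoin_top.
  pose h := fprod_meet (fmeet f1 g1) (fmeet f2 g2).
  exists (subhood h (fmeet (fprod_meet f1 f2) (fprod_meet g1 g2))).
    exists h => //; exists (fmeet f1 g1), (fmeet f2 g2); split=> //;
      exact: top_filter_meet.
  by apply: subhood_refl_le => p; rewrite /h /fprod_meet /fmeet meetACA.
Qed.

Definition top_filter_prod X1 X2
    (F1 : top_filter L X1) (F2 : top_filter L X2) : top_filter L (X1 * X2) :=
  generated_top_filter (is_top_filter_base_prod F1 F2).

End Product.

Section Convergence.
Context d (L : cdResiduatedLatticeType d).

(* [C F x] means that the filter F converges to x. *)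
Definition convergence (X : Type) := top_filter L X -> set X.

Record is_top_convergence X (C : convergence X) : Prop := IsTopConvergence {
  top_convergence_point : forall x, C (top_filter_point L x) x;
  top_convergence_le : forall (F G : top_filter L X) x,
    F `<=` G -> C F x -> C G x
}.

Definition top_continuous X Y (CX : convergence X) (CY : convergence Y)
    (f : X -> Y) : Prop :=
  forall F x, CX F x -> CY (top_filter_image f F) (f x).

Definition convergence_prod X1 X2 (C1 : convergence X1) (C2 : convergence X2) :
    convergence (X1 * X2) :=
  fun F x => C1 (top_filter_image fst F) x.1 /\ C2 (top_filter_image snd F) x.2.

Definition continuous_map X Y (CX : convergence X) (CY : convergence Y) : Type :=
  {f : X -> Y | top_continuous CX CY f}.

Definition evaluation X Y (CX : convergence X) (CY : convergence Y)
    (p : continuous_map CX CY * X) : Y :=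
  sval p.1 p.2.

Definition convergence_power X Y (CX : convergence X) (CY : convergence Y) :
    convergence (continuous_map CX CY) :=
  fun F f => forall x (G : top_filter L X), CX G x ->
    CY (top_filter_image (@evaluation _ _ CX CY) (top_filter_prod F G))
       (sval f x).

Record is_top_convergence_group (G : groupType) (C : convergence G) : Prop :=
    IsTopConvergenceGroup {
  top_group_convergence : is_top_convergence C;
  top_group_mul : top_continuous (convergence_prod C C) C
    (fun p : G * G => (p.1 * p.2)%g);
  top_group_inv : top_continuous C C (fun x : G => (x^-1)%g)
}.

End Convergence.

(* Main.v *)
Require Import Defs.
From HB Require Import structures.
From mathcomp Require Import all_boot all_order.
From mathcomp Require Import boolp classical_sets.

(** Every assertion reduces to a continuity statement in Y.

    The group laws of C(X, Y) hold pointwise.  The pointwise product of two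
    continuous maps is continuous because the pairing of f and g carries a
    filter converging to x to one converging to (f x, g x), whence the
    multiplication of Y sends it to one converging to f x * g x.

    The only real content is the continuity of the operations for the power
    structure.  Let H converge to (f, g) in C(X, Y) x C(X, Y) and G converge to
    x in X.  Write m for the multiplication of C(X, Y), and consider the map
    ((f', g'), x') |-> (f' x', g' x').  It sends H x G to a filter that
    converges to (f x, g x), by definition of the power structure applied to
    the two projections of H; so multiplication in Y yields convergence of its
    image to f x * g x.  This image is also the image under
    ev o (m x id) of H x G, and what is needed is the convergence of the image
    under ev of (m H) x G.  Inversion is treated in the same way.  Passing
    between the two forms, for m as well as for the projections of H, rests on
    one commutation property ([top_filter_image_prodl]): for any map phi,

      (phi F) x G = (phi x id) (F x G).

    One inclusion holds by precomposition.  The other needs the direct image of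
    a member of F along phi, given by joins over the fibres of phi, and the
    distributivity of meets over joins in L, law (CD), to compare the product
    of this direct image by a member of G with the direct image of the
    product. *)

Section PowerGroup.

Set Implicit Arguments.
Unset Strict Implicit.

Import Order.TTheory.
Local Open Scope classical_set_scope.
Local Open Scope order_scope.

(** * Filters and their products *)

Section Filters.
Context d (L : cdResiduatedLatticeType d).

Lemma bigjoin_eq_top_mono (A B : set L) :
  (forall a, A a -> exists2 b, B b & a <= b) ->
  bigjoin A = \top -> bigjoin B = \top.
Proof.
move=> AB A1; apply/le_anti; rewrite lex1/= -A1; apply: bigjoin_le => a.
by move=> /AB[b Bb ab]; apply: le_trans ab (le_bigjoin Bb).
Qed.

Lemma top_filter_up X (F : top_filter L X) (f g : X -> L) :
  top_filter_set F f -> (forall x, f x <= g x) -> top_filter_set F g.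
Proof.
move=> Ff fg; apply: (top_filter_sat (top_filterP F)).
by apply: bigjoin_top; exists (subhood f g); [exists f|exact: subhood_refl_le].
Qed.

Lemma top_filter_cst_top X (F : top_filter L X) :
  top_filter_set F (fun=> \top).
Proof.
have [f Ff] := top_filter_nonempty (top_filterP F).
by apply: top_filter_up Ff _ => x; rewrite lex1.
Qed.

Lemma top_filter_prod_meet X1 X2 (F1 : top_filter L X1) (F2 : top_filter L X2)
    f1 f2 (g : X1 * X2 -> L) :
  top_filter_set F1 f1 -> top_filter_set F2 f2 ->
  (forall p, fprod_meet f1 f2 p <= g p) ->
  top_filter_set (top_filter_prod F1 F2) g.
Proof.
move=> Ff1 Ff2 fg; apply: bigjoin_top; exists (subhood (fprod_meet f1 f2) g).
  by exists (fprod_meet f1 f2) => //; exists f1, f2.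
exact: subhood_refl_le.
Qed.

Lemma top_filter_prod_subl X1 X2 (F F' : top_filter L X1)
    (G : top_filter L X2) :
  top_filter_set F `<=` top_filter_set F' ->
  top_filter_set (top_filter_prod F G) `<=`
  top_filter_set (top_filter_prod F' G).
Proof.
move=> FF' g; apply: bigjoin_eq_top_mono => _ [_ [f1 [f2 [Ff1 Gf2 ->]]] <-].
exists (subhood (fprod_meet f1 f2) g) => //.
by exists (fprod_meet f1 f2) => //; exists f1, f2; split=> //; exact: FF'.
Qed.

(** The direct image of [f] along [phi], left adjoint to precomposition. *)
Definition fibre_join X Y (phi : X -> Y) (f : X -> L) (y : Y) : L :=
  bigjoin [set f x | x in [set x | phi x = y]].

Lemma le_fibre_join X Y (phi : X -> Y) (f : X -> L) x :
  f x <= fibre_join phi f (phi x).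
Proof. by apply: le_bigjoin; exists x. Qed.

(** The adjunction for [phi x id], graded by the subsethood degree.  Law (CD)
    moves the meet with [f2] inside the join over a fibre, and the residuated
    product then distributes over that join. *)
Lemma subhood_fibre_join X1 X2 Y1 (phi : X1 -> Y1) (f1 : X1 -> L)
    (f2 : X2 -> L) (g : Y1 * X2 -> L) :
  subhood (fprod_meet f1 f2) (fun p => g (phi p.1, p.2)) <=
  subhood (fprod_meet (fibre_join phi f1) f2) g.
Proof.
set c := subhood _ _; apply/subhoodP => -[y x2].
have /subhoodP fg := lexx c.
rewrite /fprod_meet /= meetC /fibre_join meet_bigjoin resmulC resmul_bigjoin.
apply: bigjoin_le => _ [_ [_ [x1 /= <-] <-] <-] <-.
by rewrite resmulC meetC; apply: (fg (x1, x2)).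
Qed.

(** From left to right, a base member f1 x f2 is precomposed with [phi x id];
    from right to left, a member f1 of F is replaced by its join over fibres,
    whose pullback along [phi] lies above f1 and hence in F. *)
Lemma top_filter_image_prodl X1 X2 Y1 (phi : X1 -> Y1) (F : top_filter L X1)
    (G : top_filter L X2) :
  top_filter_set (top_filter_prod (top_filter_image phi F) G) =
  top_filter_set (top_filter_image (fun p => (phi p.1, p.2))
                                   (top_filter_prod F G)).
Proof.
apply/seteqP; split=> g.
- apply: bigjoin_eq_top_mono => _ [_ [f1 [f2 [Ff1 Gf2 ->]]] <-].
  exists (subhood (fprod_meet (f1 \o phi) f2) (fun p => g (phi p.1, p.2))).
    by exists (fprod_meet (f1 \o phi) f2) => //; exists (f1 \o phi), f2.
  apply/subhoodP => -[x1 x2].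
  by have /subhoodP/(_ (phi x1, x2)) := lexx (subhood (fprod_meet f1 f2) g).
- apply: bigjoin_eq_top_mono => _ [_ [f1 [f2 [Ff1 Gf2 ->]]] <-].
  exists (subhood (fprod_meet (fibre_join phi f1) f2) g).
    exists (fprod_meet (fibre_join phi f1) f2) => //.
    exists (fibre_join phi f1), f2; split=> //.
    by apply: (top_filter_up Ff1) => x; exact: le_fibre_join.
  exact: subhood_fibre_join.
Qed.

End Filters.

(** * The power object as a convergence space *)

Section Power.
Context d (L : cdResiduatedLatticeType d) (X Y : Type).
Context (CX : convergence L X) (CY : convergence L Y).
Hypothesis convY : is_top_convergence CY.

(** The crisp singleton of [f] belongs to the point filter of [f], and its
    product by [g o f] lies below [g o ev]; so [ev ([f] x G)] contains [f G]. *)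
Lemma convergence_power_point (f : continuous_map CX CY) :
  convergence_power (top_filter_point L f) f.
Proof.
move=> x G Gx; apply: (top_convergence_le convY) (svalP f _ _ Gx) => g Gg.
pose one_f h : L := if `[< h = f >] then \top else \bot.
apply: (top_filter_prod_meet (f1 := one_f) (f2 := g \o sval f)) => //.
  by rewrite /= /one_f asboolT.
move=> [h y]; rewrite /fprod_meet /one_f /=.
by case: asboolP => [->|_]; rewrite ?leIr// meet0x le0x.
Qed.

Lemma is_top_convergence_power :
  is_top_convergence (convergence_power (CX := CX) (CY := CY)).
Proof.
split=> [f|F F' f FF' Ff x G Gx]; first exact: convergence_power_point.
apply: (top_convergence_le convY) (Ff _ _ Gx) => g.
exact: (top_filter_prod_subl FF').
Qed.

(** The form in which convergence in the power object is used: evaluation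
    after a change of the function variable. *)
Lemma convergence_power_image Z (phi : Z -> continuous_map CX CY)
    (F : top_filter L Z) (f : continuous_map CX CY) :
  convergence_power (top_filter_image phi F) f <->
  (forall x (G : top_filter L X), CX G x ->
    CY (top_filter_image (fun p => sval (phi p.1) p.2) (top_filter_prod F G))
       (sval f x)).
Proof.
split=> h x G Gx; apply: (top_convergence_le convY) (h x G Gx) => g /=;
  have /seteqP[sub sup] := top_filter_image_prodl phi F G.
- exact: (sub (g \o @evaluation _ _ _ _ CX CY)).
- exact: (sup (g \o @evaluation _ _ _ _ CX CY)).
Qed.

End Power.

(** * Pointwise group structure *)

Section Group.
Context d (L : cdResiduatedLatticeType d) (X : Type) (Y : groupType).
Context (CX : convergence L X) (CY : convergence L Y).
Hypothesis groupY : is_top_convergence_group CY.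

Let convY := top_group_convergence groupY.

Lemma top_convergence_mul Z (F : top_filter L Z) (u v : Z -> Y) (a b : Y) :
  CY (top_filter_image u F) a -> CY (top_filter_image v F) b ->
  CY (top_filter_image (fun z => u z * v z)%g F) (a * b)%g.
Proof.
move=> Fa Fb.
have FP : convergence_prod CY CY
    (top_filter_image (fun z => (u z, v z)) F) (a, b).
  by split; [apply: (top_convergence_le convY) Fa
            |apply: (top_convergence_le convY) Fb].
exact: (top_convergence_le convY) (top_group_mul groupY FP).
Qed.

Lemma top_convergence_inv Z (F : top_filter L Z) (u : Z -> Y) (a : Y) :
  CY (top_filter_image u F) a ->
  CY (top_filter_image (fun z => (u z)^-1)%g F) (a^-1)%g.
Proof.
by move=> Fa; apply: (top_convergence_le convY) (top_group_inv groupY Fa).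
Qed.

Lemma top_continuous_cst (a : Y) : top_continuous CX CY (fun=> a).
Proof.
move=> F x _; apply: (top_convergence_le convY) (top_convergence_point convY a).
move=> g /= ga; apply: top_filter_up (top_filter_cst_top F) _ => z /=.
by rewrite ga.
Qed.

Lemma top_continuous_mul (f g : X -> Y) :
  top_continuous CX CY f -> top_continuous CX CY g ->
  top_continuous CX CY (fun x => f x * g x)%g.
Proof.
by move=> cf cg F x Fx; exact: top_convergence_mul (cf _ _ _) (cg _ _ _).
Qed.

Lemma top_continuous_inv (f : X -> Y) :
  top_continuous CX CY f -> top_continuous CX CY (fun x => (f x)^-1)%g.
Proof. by move=> cf F x Fx; exact: top_convergence_inv (cf _ _ _). Qed.

Definition cmap_one : continuous_map CX CY :=
  exist _ _ (top_continuous_cst 1%g).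

Definition cmap_mul (f g : continuous_map CX CY) : continuous_map CX CY :=
  exist _ _ (top_continuous_mul (svalP f) (svalP g)).

Definition cmap_inv (f : continuous_map CX CY) : continuous_map CX CY :=
  exist _ _ (top_continuous_inv (svalP f)).

Lemma cmap_ext (f g : continuous_map CX CY) : sval f =1 sval g -> f = g.
Proof. by case: f g => [f cf] [g cg] /= /funext fg; exact: eq_exist. Qed.

Lemma cmap_mulA : associative cmap_mul.
Proof. by move=> f g h; apply: cmap_ext => x /=; rewrite mulgA. Qed.

Lemma cmap_mul1g : left_id cmap_one cmap_mul.
Proof. by move=> f; apply: cmap_ext => x /=; rewrite mul1g. Qed.

Lemma cmap_mulg1 : right_id cmap_one cmap_mul.
Proof. by move=> f; apply: cmap_ext => x /=; rewrite mulg1. Qed.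

Lemma cmap_mulVg : left_inverse cmap_one cmap_inv cmap_mul.
Proof. by move=> f; apply: cmap_ext => x /=; rewrite mulVg. Qed.

Lemma cmap_mulgV : right_inverse cmap_one cmap_inv cmap_mul.
Proof. by move=> f; apply: cmap_ext => x /=; rewrite mulgV. Qed.

Lemma cmap_mul_continuous :
  top_continuous
    (convergence_prod (convergence_power (CX := CX) (CY := CY))
                      (convergence_power (CX := CX) (CY := CY)))
    (convergence_power (CX := CX) (CY := CY))
    (fun p => cmap_mul p.1 p.2).
Proof.
move=> H [f g] [Hf Hg]; apply/(convergence_power_image convY) => x G Gx.
have /(convergence_power_image convY) fx := Hf.
have /(convergence_power_image convY) gx := Hg.
exact: (top_convergence_mul (fx x G Gx) (gx x G Gx)).
Qed.

Lemma cmap_inv_continuous :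
  top_continuous (convergence_power (CX := CX) (CY := CY))
    (convergence_power (CX := CX) (CY := CY)) cmap_inv.
Proof.
move=> F f Ff; apply/(convergence_power_image convY) => x G Gx.
exact: (top_convergence_inv (Ff x G Gx)).
Qed.

(** The hypothesis on Y has to be an argument of the carrier, since the
    continuity of the pointwise operations depends on it. *)
Definition cmap_group of is_top_convergence_group CY : Type :=
  continuous_map CX CY.

HB.instance Definition _ := gen_eqMixin (cmap_group groupY).
HB.instance Definition _ := gen_choiceMixin (cmap_group groupY).
HB.instance Definition _ := isGroup.Build (cmap_group groupY)
  cmap_mulA cmap_mul1g cmap_mulg1 cmap_mulVg cmap_mulgV.

End Group.

End PowerGroup.

Theorem theorem6p8 (d : Order.disp_t) (L : cdResiduatedLatticeType d)
    (X Y : groupType) (CX : convergence L X) (CY : convergence L Y)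
    (hX : is_top_convergence_group CX) (hY : is_top_convergence_group CY) :
  exists cG : Group.axioms_ (continuous_map CX CY),
    let G : groupType := Group.Pack cG in
    (forall (f g : G) (x : X), sval (f * g)%g x = (sval f x * sval g x)%g) /\
    is_top_convergence_group (G := G) (convergence_power (CX := CX) (CY := CY)).
Proof.
exists (Group.class (cmap_group CX hY : groupType)); split=> //; split.
- exact: is_top_convergence_power (top_group_convergence hY).
- exact: cmap_mul_continuous.
- exact: cmap_inv_continuous.
Qed.
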